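(* Let $G$ be an extension of a residually (torsion-free nilpotent) group $K$ by a bi-orderable abelian group $\Phi$ (that is, $K\triangleleft G$ and $G/K\cong\Phi$). Suppose that the real vector space $V=K^{\mathrm{ab}}\otimes_{\mathbb{Z}}\mathbb{R}$ is finite-dimensional, and that all eigenvalues of the linear maps induced on $V$ by elements of $\Phi$ are positive real numbers. Then $G$ is bi-orderable.
   Context: A group $G$ is bi-orderable if there is a total order $<$ on $G$ such that $u<v$ implies $ux<vx$ and $xu<xv$ for all $u,v,x\in G$. $K^{\mathrm{ab}}=K/K'$ is the abelianization. The group $\Phi\cong G/K$ acts on $K^{\mathrm{ab}}$, and hence on $V$, via conjugation in $G$. ''All eigenvalues are positive real numbers'' means that all complex roots of the characteristic polynomial are real and positive. A group is residually (torsion-free nilpotent) if for each non-identity element there is a homomorphism to a torsion-free nilpotent group not killing it. *)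

(* Defs.v *)
From HB Require Import structures.
From mathcomp Require Import all_boot all_order all_algebra.
From mathcomp Require Import boolp classical_sets reals complex freeg.

Set Implicit Arguments.
Unset Strict Implicit.
Unset Printing Implicit Defensive.

Import GRing.Theory.

Local Open Scope classical_set_scope.
Local Open Scope quotient_scope.
Local Open Scope group_scope.

(* Groups are MathComp's [groupType]s, which may be infinite.  Their
   [choiceType] structure is no restriction: [boolp] provides one on every
   type. *)

Definition bi_orderable (G : groupType) : Prop :=
  exists lt : G -> G -> Prop,
    [/\ forall x, ~ lt x x,
        forall x y z, lt x y -> lt y z -> lt x z,
        forall x y, [\/ lt x y, x = y | lt y x] &
        forall u v x, lt u v -> lt (u * x) (v * x) /\ lt (x * u) (x * v)].

Inductive generated (G : groupType) (A : set G) : set G :=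
| generated_in x : A x -> generated A x
| generated1 : generated A 1
| generatedM x y : generated A x -> generated A y -> generated A (x * y)
| generatedV x : generated A x -> generated A x^-1.

(* Indexed from 0: [lower_central G 0] is all of [G]. *)
Fixpoint lower_central (G : groupType) (n : nat) : set G :=
  if n is n'.+1 then
    generated [set [~ x, y] | x in lower_central n' & y in [set: G]]
  else [set: G].
Arguments lower_central : clear implicits.

Definition nilpotent_group (G : groupType) : Prop :=
  exists n, lower_central G n `<=` [set 1].

Definition torsion_free (G : groupType) : Prop :=
  forall (x : G) (n : nat), x ^+ n.+1 = 1 -> x = 1.

Definition residually_torsion_free_nilpotent (G : groupType) : Prop :=
  forall x : G, x <> 1 ->
    exists (N : groupType) (f : {multiplicative G -> N}),
      [/\ nilpotent_group N, torsion_free N & f x <> 1].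

HB.mixin Record isNormalClosed (G : groupType) (S : {pred G}) := {
  gpredJ_normal : {in S, forall x g, x ^ g \in S}
}.

#[short(type="normalClosed")]
HB.structure Definition NormalClosed (G : groupType) :=
  {S of isNormalClosed G S & GroupClosed G S}.

Section Subgroup.
Variables (G : groupType) (K : groupClosed G).

Record subg := Subg { subg_val : G; subg_valP : subg_val \in K }.

HB.instance Definition _ := [isSub of subg for subg_val].
HB.instance Definition _ := [Choice of subg by <:].

Lemma subg_group_closed : group_closed K.
Proof. by split; [exact: gpred1 | exact: gpredF]. Qed.

HB.instance Definition _ :=
  SubChoice_isSubGroup.Build G (fun x => x \in K) subg subg_group_closed.

End Subgroup.

Section Quotient.
Variables (G : groupType) (N : normalClosed G).

Definition coset_rel : rel G := fun x y => x^-1 * y \in N.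

Lemma coset_rel_refl : reflexive coset_rel.
Proof. by move=> x; rewrite /coset_rel mulVg gpred1. Qed.

Lemma coset_rel_sym : symmetric coset_rel.
Proof.
by move=> x y; rewrite /coset_rel -(gpredV N) invgM invgK.
Qed.

Lemma coset_rel_trans : transitive coset_rel.
Proof.
move=> y x z xy yz; have := gpredM _ _ xy yz.
by rewrite /coset_rel mulgA mulgK.
Qed.

Canonical coset_equiv :=
  EquivRel coset_rel coset_rel_refl coset_rel_sym coset_rel_trans.

Definition quotg := {eq_quot coset_rel}.

HB.instance Definition _ := Choice.on quotg.
HB.instance Definition _ := Quotient.on quotg.
HB.instance Definition _ : EqQuotient _ coset_rel quotg := EqQuotient.on quotg.

Definition quotg_one : quotg := \pi_quotg 1.
Definition quotg_mul (a b : quotg) : quotg := \pi_quotg (repr a * repr b).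
Definition quotg_inv (a : quotg) : quotg := \pi_quotg (repr a)^-1.

Lemma quotg_eqP x y : (\pi_quotg x = \pi_quotg y) <-> x^-1 * y \in N.
Proof. by split=> [/eqquotP|h]; [|apply/eqquotP]. Qed.

Lemma quotg_reprP x : (repr (\pi_quotg x))^-1 * x \in N.
Proof. by apply/quotg_eqP; rewrite reprK. Qed.

Lemma quotg_piM x y : quotg_mul (\pi_quotg x) (\pi_quotg y) = \pi_quotg (x * y).
Proof.
apply/quotg_eqP; set x' := repr _; set y' := repr _.
have hx : x'^-1 * x \in N := quotg_reprP x.
have hy : y'^-1 * y \in N := quotg_reprP y.
have -> : (x' * y')^-1 * (x * y) = (x'^-1 * x) ^ y' * (y'^-1 * y).
  by rewrite /conjg invgM !mulgA mulgK.
by rewrite gpredM// gpredJ_normal.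
Qed.

Lemma quotg_piV x : quotg_inv (\pi_quotg x) = \pi_quotg x^-1.
Proof.
apply/quotg_eqP; set x' := repr _.
have hx : x'^-1 * x \in N := quotg_reprP x.
rewrite invgK -(gpredV N) invgM invgK.
have -> : x * x'^-1 = (x'^-1 * x) ^ x'^-1 by rewrite /conjg invgK !mulgA mulgV mul1g.
exact: gpredJ_normal.
Qed.

Lemma quotg_ind (P : quotg -> Prop) : (forall x, P (\pi_quotg x)) -> forall a, P a.
Proof. by move=> h a; rewrite -(reprK a). Qed.

Lemma quotg_mulA : associative quotg_mul.
Proof.
by elim/quotg_ind=> x; elim/quotg_ind=> y; elim/quotg_ind=> z; rewrite !quotg_piM mulgA.
Qed.

Lemma quotg_mul1 : left_id quotg_one quotg_mul.
Proof. by elim/quotg_ind=> x; rewrite quotg_piM mul1g. Qed.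

Lemma quotg_mulg1 : right_id quotg_one quotg_mul.
Proof. by elim/quotg_ind=> x; rewrite quotg_piM mulg1. Qed.

Lemma quotg_mulV : left_inverse quotg_one quotg_inv quotg_mul.
Proof. by elim/quotg_ind=> x; rewrite quotg_piV quotg_piM mulVg. Qed.

Lemma quotg_mulgV : right_inverse quotg_one quotg_inv quotg_mul.
Proof. by elim/quotg_ind=> x; rewrite quotg_piV quotg_piM mulgV. Qed.

HB.instance Definition _ := isGroup.Build quotg
  quotg_mulA quotg_mul1 quotg_mulg1 quotg_mulV quotg_mulgV.

Definition quotg_pi (x : G) : quotg := \pi_quotg x.

Lemma quotg_pi_morph : {morph quotg_pi : x y / x * y}.
Proof. by move=> x y; rewrite /quotg_pi -quotg_piM. Qed.

HB.instance Definition _ := isMultiplicative.Build G quotg quotg_pi quotg_pi_morph.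

End Quotient.

Section Abelianization.
Variable G : groupType.

Definition derived : {pred G} :=
  fun x => `[< generated [set [~ y, z] | y in [set: G] & z in [set: G]] x >].

Lemma derivedP x : reflect
  (generated [set [~ y, z] | y in [set: G] & z in [set: G]] x) (x \in derived).
Proof. exact: asboolP. Qed.

Lemma derived_mul : mulg_closed derived.
Proof. by move=> x y /derivedP hx /derivedP hy; apply/derivedP/generatedM. Qed.

Lemma derived_one : 1 \in derived.
Proof. exact/derivedP/generated1. Qed.

Lemma derived_inv : invg_closed derived.
Proof. by move=> x /derivedP hx; apply/derivedP/generatedV. Qed.

Lemma derived_comm x y : [~ x, y] \in derived.
Proof. by apply/derivedP/generated_in; exists x => //; exists y. Qed.

Lemma derived_normal : {in derived, forall x g, x ^ g \in derived}.
Proof.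
move=> x hx g; have -> : x ^ g = x * [~ x, g] by rewrite /commg mulgA mulgV mul1g.
by apply: derived_mul => //; exact: derived_comm.
Qed.

HB.instance Definition _ := isMulClosed.Build G derived derived_mul.
HB.instance Definition _ := isMul1Closed.Build G derived derived_one.
HB.instance Definition _ := isInvClosed.Build G derived derived_inv.
HB.instance Definition _ := isNormalClosed.Build G derived derived_normal.

(* [G / G'], written additively. *)
Definition abelianization := quotg derived.

HB.instance Definition _ := Group.on abelianization.

Definition ab_pi (x : G) : abelianization := quotg_pi derived x.

Lemma ab_addC : commutative (@quotg_mul G derived).
Proof.
elim/quotg_ind=> x; elim/quotg_ind=> y; rewrite !quotg_piM; apply/quotg_eqP.
rewrite invgM -mulgA; exact: derived_comm.
Qed.

HB.instance Definition _ := GRing.isZmodule.Build abelianization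
  (@quotg_mulA G derived) ab_addC (@quotg_mul1 G derived) (@quotg_mulV G derived).

Lemma ab_piM x y : ab_pi (x * y) = (ab_pi x + ab_pi y)%R.
Proof. exact: quotg_pi_morph. Qed.

Lemma ab_pi_eqP x y : ab_pi x = ab_pi y <-> x^-1 * y \in derived.
Proof. exact: quotg_eqP. Qed.

Lemma ab_pi_surj (a : abelianization) : exists x, a = ab_pi x.
Proof. by exists (repr a); rewrite /ab_pi /quotg_pi reprK. Qed.

End Abelianization.
Arguments derived : clear implicits.

Section AbelianizationMap.
Variables (G H : groupType) (f : {multiplicative G -> H}).

Definition ab_map (a : abelianization G) : abelianization H :=
  ab_pi (f (repr (a : quotg (derived G)))).

Lemma morph_derived x : x \in derived G -> f x \in derived H.
Proof.
have f1 : f 1 = 1 by apply: (mulgI (f 1)); rewrite -gmulfM !mulg1.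
have fV y : f y^-1 = (f y)^-1.
  by apply: (mulgI (f y)); rewrite -gmulfM !mulgV.
move=> /derivedP; elim=> {x} [_ [y _ [z _ <-]]||x y _ hx _ hy|x _ hx].
- by rewrite /commg /conjg !gmulfM !fV; exact: derived_comm.
- by rewrite f1 derived_one.
- by rewrite gmulfM derived_mul.
- by rewrite fV derived_inv.
Qed.

Lemma ab_mapE x : ab_map (ab_pi x) = ab_pi (f x).
Proof.
apply/ab_pi_eqP; set y := repr _.
have f1 : f 1 = 1 by apply: (mulgI (f 1)); rewrite -gmulfM !mulg1.
have -> : (f y)^-1 = f y^-1.
  by apply: (mulgI (f y)); rewrite -gmulfM !mulgV.
by rewrite -gmulfM; apply: morph_derived; exact: quotg_reprP.
Qed.

Lemma ab_map_is_additive : additive ab_map.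
Proof.
move=> a b; have [x ->] := ab_pi_surj a; have [y ->] := ab_pi_surj b.
apply: (@addIr _ (ab_map (ab_pi y))); rewrite subrK.
have : (ab_pi x - ab_pi y)%R = ab_pi (x * y^-1).
  by apply: (@addIr _ (ab_pi y)); rewrite subrK -ab_piM mulgVK.
by move->; rewrite !ab_mapE -ab_piM -gmulfM mulgVK.
Qed.

HB.instance Definition _ := GRing.isAdditive.Build _ _ ab_map ab_map_is_additive.

End AbelianizationMap.

Section Tensor.
Local Open Scope ring_scope.
Variables (M : zmodType) (R : nzRingType).

Local Notation F := {freeg (M * R) / int}.
Local Notation gen m r := (<< (m, r) >> : F).

(* The subgroup spanned by the biadditivity relations. *)
Inductive tensor_rel : set F :=
| tensor_relDl m1 m2 r :
    tensor_rel (gen (m1 + m2) r - gen m1 r - gen m2 r)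
| tensor_relDr m r1 r2 :
    tensor_rel (gen m (r1 + r2) - gen m r1 - gen m r2)
| tensor_rel0 : tensor_rel 0
| tensor_relB u v : tensor_rel u -> tensor_rel v -> tensor_rel (u - v).

Definition tensor_ker : {pred F} := fun u => `[< tensor_rel u >].

Lemma tensor_kerP u : reflect (tensor_rel u) (u \in tensor_ker).
Proof. exact: asboolP. Qed.

Lemma tensor_ker_zmod : zmod_closed tensor_ker.
Proof.
split; first exact/tensor_kerP/tensor_rel0.
by move=> u v /tensor_kerP hu /tensor_kerP hv; apply/tensor_kerP/tensor_relB.
Qed.

HB.instance Definition _ := GRing.isZmodClosed.Build F tensor_ker tensor_ker_zmod.

(* M (x)_Z R, with R acting by left multiplication on the second factor. *)
Definition tensor := Quotient.quot tensor_ker.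

HB.instance Definition _ := GRing.Zmodule.on tensor.
HB.instance Definition _ := Quotient.on tensor.

Definition tensor_pi (u : F) : tensor := \pi_tensor u.

Lemma tensor_pi_is_additive : additive tensor_pi.
Proof. by move=> u v; rewrite /tensor_pi !piE. Qed.

HB.instance Definition _ :=
  GRing.isAdditive.Build F tensor tensor_pi tensor_pi_is_additive.

Lemma tensor_pi_eqP u v : tensor_pi u = tensor_pi v <-> tensor_rel (u - v).
Proof.
split=> [/eqP|h]; first by rewrite -Quotient.idealrBE => /tensor_kerP.
by apply/eqP; rewrite -Quotient.idealrBE; apply/tensor_kerP.
Qed.

Lemma tensor_pi_surj (t : tensor) : exists u, t = tensor_pi u.
Proof. by exists (repr t); rewrite /tensor_pi reprK. Qed.

Definition tens (m : M) (r : R) : tensor := tensor_pi (gen m r).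

Lemma tensDl m1 m2 r : tens (m1 + m2) r = tens m1 r + tens m2 r.
Proof.
by rewrite -raddfD; apply/tensor_pi_eqP; rewrite opprD addrA; exact: tensor_relDl.
Qed.

Lemma tensDr m r1 r2 : tens m (r1 + r2) = tens m r1 + tens m r2.
Proof.
by rewrite -raddfD; apply/tensor_pi_eqP; rewrite opprD addrA; exact: tensor_relDr.
Qed.

Lemma freeg_additive_ext (A : zmodType) (f g : {additive F -> A}) :
  (forall m r, f (gen m r) = g (gen m r)) -> f =1 g.
Proof.
move=> fg u; rewrite -[u]freeg_sumE !raddf_sum; apply: eq_bigr => -[m r] _.
by rewrite -(intz (coeff _ u)) -freegU_mulz !raddfMz fg.
Qed.

Lemma tensor_additive_ext (A : zmodType) (f g : {additive tensor -> A}) :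
  (forall m r, f (tens m r) = g (tens m r)) -> f =1 g.
Proof.
move=> fg t; have [u ->] := tensor_pi_surj t.
exact: (@freeg_additive_ext _ (f \o tensor_pi) (g \o tensor_pi) fg u).
Qed.

End Tensor.
Arguments tensor : clear implicits.

Section TensorLift.
Local Open Scope ring_scope.
Variables (M : zmodType) (R : nzRingType) (M' : zmodType).
Local Notation F := {freeg (M * R) / int}.
Local Notation F' := {freeg (M' * R) / int}.
Variables (h : M -> M') (k : R -> R).

Definition gen_map : F -> F' :=
  fglift (fun p : M * R => << (h p.1, k p.2) >> : F').

Lemma gen_mapE m r : gen_map << (m, r) >> = << (h m, k r) >>.
Proof. by rewrite /gen_map liftU scale1r. Qed.

HB.instance Definition _ :=
  GRing.isAdditive.Build F F' gen_map (lift_is_additive _).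

(* For additive [h] and [k], this is the additive map sending [tens m r] to
   [tens (h m) (k r)], see [tensor_mapE]. *)
Definition tensor_map (t : tensor M R) : tensor M' R :=
  tensor_pi (gen_map (repr t)).

Hypothesis hD : {morph h : x y / x + y}.
Hypothesis kD : {morph k : x y / x + y}.

Lemma gen_map_rel u : tensor_rel u -> tensor_rel (gen_map u).
Proof.
elim=> {u} [m1 m2 r|m r1 r2||u v _ hu _ hv].
- by rewrite !raddfB /= !gen_mapE hD; exact: tensor_relDl.
- by rewrite !raddfB /= !gen_mapE kD; exact: tensor_relDr.
- by rewrite raddf0; exact: tensor_rel0.
- by rewrite raddfB; exact: tensor_relB.
Qed.

Lemma tensor_map_pi u : tensor_map (tensor_pi u) = tensor_pi (gen_map u).
Proof.
apply/tensor_pi_eqP; rewrite -raddfB; apply: gen_map_rel; apply/tensor_pi_eqP.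
by rewrite /tensor_pi reprK.
Qed.

Lemma tensor_map_additive : additive tensor_map.
Proof.
move=> a b; have [u ->] := tensor_pi_surj a; have [v ->] := tensor_pi_surj b.
by rewrite -raddfB !tensor_map_pi !raddfB.
Qed.

Lemma tensor_mapE m r : tensor_map (tens m r) = tens (h m) (k r).
Proof. by rewrite tensor_map_pi gen_mapE. Qed.

End TensorLift.

Section TensorLmodule.
Local Open Scope ring_scope.
Variables (M : zmodType) (R : nzRingType).
Local Notation V := (tensor M R).

Definition tensor_scale (c : R) : V -> V := tensor_map id ( *%R c).

Let scE c m r : tensor_scale c (tens m r) = tens m (c * r).
Proof. by apply: tensor_mapE => // x y; rewrite mulrDr. Qed.

Let sc_additive c : additive (tensor_scale c).
Proof. by apply: tensor_map_additive => // x y; rewrite mulrDr. Qed.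

HB.instance Definition _ c :=
  GRing.isAdditive.Build V V (tensor_scale c) (sc_additive c).

Lemma tensor_scaleA c d t : tensor_scale c (tensor_scale d t) = tensor_scale (c * d) t.
Proof.
apply: (@tensor_additive_ext _ _ _ (tensor_scale c \o tensor_scale d)
  (tensor_scale (c * d))) => m r /=.
by rewrite !scE mulrA.
Qed.

Lemma tensor_scale1 : left_id 1 tensor_scale.
Proof.
move=> t; apply: (@tensor_additive_ext _ _ _ (tensor_scale 1) idfun) => m r.
by rewrite /= scE mul1r.
Qed.

Lemma tensor_scaleDr : right_distributive tensor_scale +%R.
Proof. by move=> c a b; rewrite raddfD. Qed.

Lemma tensor_scaleDl t : {morph tensor_scale^~ t : c d / c + d}.
Proof.
move=> c d.
apply: (@tensor_additive_ext _ _ _ (tensor_scale (c + d))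
  (tensor_scale c \+ tensor_scale d)) => m r /=.
by rewrite !scE mulrDl tensDr.
Qed.

HB.instance Definition _ := GRing.Zmodule_isLmodule.Build R V
  tensor_scaleA tensor_scale1 tensor_scaleDr tensor_scaleDl.

Lemma tens_scale c m r : c *: tens m r = tens m (c * r).
Proof. exact: scE. Qed.

End TensorLmodule.

Section TensorMapLinear.
Local Open Scope ring_scope.
Variables (M M' : zmodType) (R : nzRingType) (f : {additive M -> M'}).

(* f (x) R *)
Definition base_change : tensor M R -> tensor M' R := tensor_map f id.

Lemma base_changeE m r : base_change (tens m r) = tens (f m) r.
Proof. by apply: tensor_mapE => //; exact: raddfD. Qed.

Lemma base_change_additive : additive base_change.
Proof. by apply: tensor_map_additive => //; exact: raddfD. Qed.

HB.instance Definition _ :=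
  GRing.isAdditive.Build _ _ base_change base_change_additive.

Lemma base_change_scalable : scalable base_change.
Proof.
move=> c t.
have := @tensor_additive_ext _ _ _ (base_change \o *:%R c)
  (( *:%R c : {additive _ -> _}) \o base_change) _ t.
by apply=> m r; rewrite /= tens_scale !base_changeE tens_scale.
Qed.

HB.instance Definition _ :=
  GRing.isScalable.Build R _ _ _ base_change base_change_scalable.

End TensorMapLinear.
Arguments base_change {M M'} R f t.

Section Conjugation.
Local Open Scope group_scope.
Variables (G : groupType) (K : normalClosed G).

Definition conj_sub (g : G) (x : subg K) : subg K :=
  Subg (gpredJ_normal _ (subg_valP x) g^-1).

Lemma conj_subE g x : val (conj_sub g x) = g * val x * g^-1.
Proof. by rewrite /= /conjg invgK mulgA. Qed.

Lemma conj_sub_morph g : {morph conj_sub g : x y / x * y}.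
Proof. by move=> x y; apply: val_inj; exact: conjMg. Qed.

HB.instance Definition _ g :=
  isMultiplicative.Build _ _ (conj_sub g) (conj_sub_morph g).

Variable R : realType.

Definition ab_tensor : lmodType R := tensor (abelianization (subg K)) R.

Definition conj_action (g : G) : ab_tensor -> ab_tensor :=
  base_change R (ab_map (conj_sub g)).

Lemma conj_actionE g x r :
  conj_action g (tens (ab_pi x) r) = tens (ab_pi (conj_sub g x)) r.
Proof. by rewrite /conj_action base_changeE /= ab_mapE. Qed.

(* The action of G factors through G / K. *)
Lemma conj_action_coset g h :
  quotg_pi K g = quotg_pi K h -> conj_action g =1 conj_action h.
Proof.
move=> /quotg_eqP Kgh; apply: (@tensor_additive_ext _ _ _
  (base_change R (ab_map (conj_sub g))) (base_change R (ab_map (conj_sub h)))).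
move=> m r; have [x ->] := ab_pi_surj m.
rewrite -![LHS]/(conj_action g _) -![RHS]/(conj_action h _) !conj_actionE.
congr tens; apply/ab_pi_eqP.
pose k : subg K := Subg Kgh.
have -> : conj_sub h x = conj_sub g (x ^ k^-1).
  apply: val_inj; change ((val x) ^ h^-1 = ((val x) ^ (g^-1 * h)^-1) ^ g^-1).
  by rewrite -conjgM -invgM mulgA mulgV mul1g.
have fV : (conj_sub g x)^-1 = conj_sub g x^-1.
  by apply: (mulgI (conj_sub g x)); rewrite mulgV -gmulfM mulgV;
     apply: val_inj; exact/esym/conj1g.
rewrite fV -gmulfM; apply: morph_derived; exact: derived_comm.
Qed.

End Conjugation.
Arguments conj_action {G} K R g t.

Section Eigenvalues.
Local Open Scope ring_scope.
Variables (R : realType) (V : lmodType R).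

Definition is_basis n (b : 'I_n -> V) : Prop :=
  forall v : V, exists! c : 'rV[R]_n, v = \sum_i c 0 i *: b i.

Definition finite_dimensional : Prop := exists n (b : 'I_n -> V), is_basis b.

(* The rows of [A] are the coordinates of the images of the basis vectors. *)
Definition matrix_in_basis (f : V -> V) n (b : 'I_n -> V) (A : 'M[R]_n) : Prop :=
  forall i, f (b i) = \sum_j A i j *: b j.

(* All the complex roots of the characteristic polynomial of [f] are positive
   reals; the polynomial does not depend on the basis. *)
Definition eigenvalues_positive (f : V -> V) : Prop :=
  forall n (b : 'I_n -> V) (A : 'M[R]_n), is_basis b -> matrix_in_basis f b A ->
  forall z : R[i], root (map_poly (real_complex R) (char_poly A)) z ->
  exists2 x : R, 0 < x & z = real_complex R x.

End Eigenvalues.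

(* Main.v *)
From HB Require Import structures.
Require Import Defs.
From mathcomp Require Import all_boot all_order all_algebra.
From mathcomp Require Import boolp classical_sets functions reals complex freeg.
From mathcomp Require Import ring.

Set Implicit Arguments.
Unset Strict Implicit.
Unset Printing Implicit Defensive.

Import Order.TTheory GRing.Theory Num.Theory.

Local Open Scope classical_set_scope.
Local Open Scope group_scope.

(* Filter K by the subgroups [real_lcs n], each the common kernel of the real
   functionals on its predecessor that vanish on commutators with K; it is the
   lower central series up to roots, so it has trivial intersection.  A
   functional phi on layer n + 1 is determined by (x, k) |-> phi [~ x, k], so
   eigenvalues on layer n + 1 are products of eigenvalues on layer n and on V,
   hence positive.  As the operators induced by G on a layer commute and have
   positive eigenvalues, nonempty sums of them are injective; this is exactly
   what makes a maximal invariant cone total.  The orders on the layers and on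
   Phi combine lexicographically.  Finite dimension is needed only for V: the
   other layers are handled through annihilating products of [T - a], a > 0. *)

(** * Products of [T - a] annihilating a function *)

Section ShiftOperators.
Local Open Scope ring_scope.
Variable R : realFieldType.

(** With [T f = f \o alpha], this is [(T - a) f]. [X] carries no structure, so that the same lemmas
    apply to groups, vector spaces and pairs of exponents. *)
Definition shift_sub (X : Type) (alpha : X -> X) (a : R) (f : X -> R) : X -> R :=
  fun x => f (alpha x) - a * f x.

Definition shift_subs (X : Type) (alpha : X -> X) (s : seq R) (f : X -> R) :=
  foldr (shift_sub alpha) f s.

(** An equivariant map [i] thus carries an annihilating product from one space to another. *)
Lemma shift_subs_comp (X Y : Type) (alpha : X -> X) (beta : Y -> Y)
    (i : X -> Y) s (f : Y -> R) :
  (forall x, i (alpha x) = beta (i x)) ->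
  shift_subs alpha s (f \o i) = shift_subs beta s f \o i.
Proof.
by move=> ib; elim: s => //= a s ->; apply/funext => x; rewrite /shift_sub /= ib.
Qed.

Lemma shift_subs_cat (X : Type) (alpha : X -> X) s t (f : X -> R) :
  shift_subs alpha (s ++ t) f = shift_subs alpha s (shift_subs alpha t f).
Proof. exact: foldr_cat. Qed.

Lemma shift_subsD (X : Type) (alpha : X -> X) s (f g : X -> R) :
  shift_subs alpha s (f + g) = shift_subs alpha s f + shift_subs alpha s g.
Proof.
elim: s => //= a s ->; apply/funext => x.
by rewrite /shift_sub !fctE mulrDr opprD addrACA.
Qed.

Lemma shift_subsZ (X : Type) (alpha : X -> X) s c (f : X -> R) :
  shift_subs alpha s (fun x => c * f x) = fun x => c * shift_subs alpha s f x.
Proof.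
by elim: s => //= a s ->; apply/funext => x; rewrite /shift_sub; ring.
Qed.

Lemma shift_subs0 (X : Type) (alpha : X -> X) s :
  shift_subs alpha s (fun=> 0) = fun=> 0 :> R.
Proof. by elim: s => //= a s ->; apply/funext => x; rewrite /shift_sub; ring. Qed.

Lemma shift_subE (X : Type) (alpha : X -> X) a (f : X -> R) :
  shift_sub alpha a f = f \o alpha + (fun x => - a * f x).
Proof. by apply/funext => x; rewrite /shift_sub !fctE mulNr. Qed.

Section Commuting.
Variables (X : Type) (sigma tau : X -> X).
Hypothesis st : forall x, sigma (tau x) = tau (sigma x).

Lemma shift_subs_shift_sub s b (f : X -> R) :
  shift_subs sigma s (shift_sub tau b f) = shift_sub tau b (shift_subs sigma s f).
Proof.
by rewrite !shift_subE shift_subsD shift_subsZ (@shift_subs_comp _ _ sigma sigma) // => x.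
Qed.

Lemma shift_subs_comm s t (f : X -> R) :
  shift_subs sigma s (shift_subs tau t f) = shift_subs tau t (shift_subs sigma s f).
Proof. by elim: t => //= b t <-; rewrite shift_subs_shift_sub. Qed.

End Commuting.

(* The algebra behind the eigenvalues of a tensor product: for commuting [S]
   and [T], [S T - a b = (S - a) T + a (T - b)], so modulo [prod_b (T - b)]
   the product [prod_b (S T - a b)] is a multiple of [S - a]. *)
Section ProductRoots.
Variables (X : Type) (sigma tau : X -> X).
Hypothesis st : forall x, sigma (tau x) = tau (sigma x).
Variables (s t : seq R).

Let P (f : X -> R) := shift_subs sigma s f = (fun=> 0) /\ shift_subs tau t f = (fun=> 0).

Let PD f g : P f -> P g -> P (f + g).
Proof.
by move=> [f1 f2] [g1 g2]; split; rewrite shift_subsD ?f1 ?f2 ?g1 ?g2;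
  apply/funext => x; rewrite !fctE addr0.
Qed.

Let PZ c f : P f -> P (fun x => c * f x).
Proof.
by move=> [f1 f2]; split; rewrite shift_subsZ ?f1 ?f2; apply/funext => x; rewrite mulr0.
Qed.

Let Psigma f : P f -> P (f \o sigma).
Proof.
by move=> [f1 f2]; split;
  [rewrite (@shift_subs_comp _ _ sigma sigma) ?f1|rewrite (@shift_subs_comp _ _ tau tau) ?f2].
Qed.

Let Ptau f : P f -> P (f \o tau).
Proof.
by move=> [f1 f2]; split;
  [rewrite (@shift_subs_comp _ _ sigma sigma) ?f1|rewrite (@shift_subs_comp _ _ tau tau) ?f2].
Qed.

Let Pst f : P f -> P (f \o (sigma \o tau)).
Proof. by move=> Pf; apply: (@Ptau (f \o sigma)); exact: Psigma. Qed.

Let Pshift alpha a f :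
  (forall g, P g -> P (g \o alpha)) -> P f -> P (shift_sub alpha a f).
Proof. by move=> Pa Pf; rewrite shift_subE; apply: PD; [exact: Pa|exact: PZ]. Qed.

Let Pshifts alpha u f :
  (forall g, P g -> P (g \o alpha)) -> P f -> P (shift_subs alpha u f).
Proof. by move=> Pa Pf; elim: u => //= a u; exact: Pshift. Qed.

Let one_factor a u f : P f -> exists2 g, P g &
  shift_subs (sigma \o tau) [seq a * b | b <- u] f =
  (fun x => a ^+ size u * shift_subs tau u f x) + shift_sub sigma a g.
Proof.
move=> Pf; elim: u => [|b u [g Pg IH]] /=.
  exists (fun=> 0); first by split; rewrite shift_subs0.
  by apply/funext => x; rewrite /shift_sub !fctE expr0; ring.
set F := shift_subs tau u f in IH *.
(* With [S], [T] the operators of [sigma], [tau]: [(S T - a b) F = a (T - b) F + (S - a) T F], and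
   the last term joins the multiple of [S - a]. *)
exists ((fun x => a ^+ size u * (F \o tau) x) + shift_sub (sigma \o tau) (a * b) g).
  by apply: PD; [apply/PZ/Ptau/Pshifts|exact: Pshift].
rewrite IH; apply/funext => x; rewrite /shift_sub !fctE /= -!st exprS.
by ring.
Qed.

Lemma shift_subs_allpairs f :
  shift_subs sigma s f = (fun=> 0) -> shift_subs tau t f = (fun=> 0) ->
  shift_subs (sigma \o tau) [seq a * b | a <- s, b <- t] f = fun=> 0.
Proof.
move=> f1 f2; have Pf : P f by [].
have sst x : sigma ((sigma \o tau) x) = (sigma \o tau) (sigma x) by rewrite /= st.
(* For each [a] in [s], the block of factors [S T - a b], [b] in [t], turns a member of [P] into
   [(S - a) h] with [h] again in [P]. *)
suff [g [gs _] ->] : exists2 g, P g &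
    shift_subs (sigma \o tau) [seq a * b | a <- s, b <- t] f = shift_subs sigma s g.
  by [].
elim: (s) => [|a s' [g Pg IH]] /=; first by exists f.
have [h Ph hE] := one_factor a t Pg.
exists h => //; rewrite shift_subs_cat IH.
rewrite -(shift_subs_comm sst) hE (_ : _ + _ = shift_sub sigma a h).
  by rewrite shift_subs_shift_sub.
by case: Pg => _ ->; apply/funext => x; rewrite !fctE mulr0 add0r.
Qed.

End ProductRoots.

(** The last nonzero partial product applied to [f] is an eigenvector of the first operator; the
    others preserve its eigenspace, so induction on [l] continues there. [P] is kept abstract to
    absorb the successive eigenspaces. *)
Lemma common_eigenvector (X I : Type) (T : I -> X -> X) (l : seq I)
    (P : (X -> R) -> Prop) (f : X -> R) :
  (forall i j x, T i (T j x) = T j (T i x)) ->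
  (forall i a g, P g -> P (shift_sub (T i) a g)) ->
  (forall i, List.In i l -> exists2 s, all (fun a => 0 < a) s &
     shift_subs (T i) s f = (fun=> 0)) ->
  P f -> f <> (fun=> 0) ->
  exists g, [/\ P g, g <> (fun=> 0) & forall i, List.In i l ->
    exists2 a, 0 < a & forall x, g (T i x) = a * g x].
Proof.
move=> TC; elim: l P f => [|i l IH] P f Psh ann Pf f0; first by exists f.
have [s s0 fs] := ann i (or_introl erefl).
pose Q g := [/\ P g & forall j, List.In j l ->
  exists2 s, all (fun a => 0 < a) s & shift_subs (T j) s g = (fun=> 0)].
have Qsh j a g : Q g -> Q (shift_sub (T j) a g).
  move=> [Pg ag]; split=> [|k /ag[u u0 ug]]; first exact: Psh.
  exists u => //; rewrite shift_subs_shift_sub// ug.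
  by apply/funext => x; rewrite /shift_sub mulr0 subr0.
have Qf : Q f by split=> // j jl; apply: ann; right.
have [a a0 [g [Qg g0 ga]]] : exists2 a, 0 < a &
    exists g, [/\ Q g, g <> (fun=> 0) & shift_sub (T i) a g = (fun=> 0)].
  elim: s s0 fs => [|a s IHs] /=; first by move=> _ /f0.
  move=> /andP[a0 s0] fs.
  have [fs0|/asboolP fs0] := pselect (shift_subs (T i) s f = (fun=> 0)).
    exact: IHs.
  exists a => //; exists (shift_subs (T i) s f); split => //.
    by elim: (s) => //= b u; exact: Qsh.
  by apply/asboolP.
pose P' g := P g /\ forall x, g (T i x) = a * g x.
have [] := IH P' g.
- move=> j b h [Ph hi]; split; first exact: Psh.
  by move=> x; rewrite /shift_sub -TC !hi; ring.
- by move=> j; apply: Qg.2.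
- split; first exact: Qg.1.
  move=> x; move/(congr1 (fun h => h x)): ga.
  by rewrite /shift_sub => /eqP; rewrite subr_eq0 => /eqP.
- exact: g0.
move=> h [[Ph hi] h0 hl]; exists h; split => // j [<-|]; first by exists a.
exact: hl.
Qed.

(** The functions killed by the sum form a space stable under every [T i - a], so a nonzero one
    yields a common eigenvector in it; there the sum acts as a sum of positive eigenvalues, which is
    not zero. *)
Lemma sum_shift_inj (X I : Type) (T : I -> X -> X) (l : seq I) (f : X -> R) :
  (forall i j x, T i (T j x) = T j (T i x)) ->
  (forall i, exists2 s, all (fun a => 0 < a) s &
     shift_subs (T i) s f = (fun=> 0)) ->
  l <> [::] -> (forall x, \sum_(i <- l) f (T i x) = 0) -> f = fun=> 0.
Proof.
move=> TC ann l0 sum0; apply: contrapT => f0.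
pose P (g : X -> R) := forall x, \sum_(i <- l) g (T i x) = 0.
have [] := @common_eigenvector X I T l P f TC _ _ sum0 f0.
- move=> i a g Pg x; rewrite /shift_sub sumrB -mulr_sumr Pg mulr0 subr0.
  by rewrite -[RHS](Pg (T i x)); apply: eq_bigr => j _; rewrite TC.
- by move=> i _; exact: ann.
move=> g [Pg g0 gl]; apply: g0; apply/funext => x.
have {}Pg := Pg x.
suff [c c0 cE] : exists2 c, 0 < c & \sum_(i <- l) g (T i x) = c * g x.
  by move: Pg; rewrite cE => /eqP; rewrite mulf_eq0 gt_eqF//= => /eqP.
elim: l l0 gl {ann sum0 P Pg} => // i l IH _ gl.
have [a a0 aE] := gl i (or_introl erefl).
have [->|l0] := pselect (l = [::]).
  by exists a => //; rewrite big_seq1 aE.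
have [//| |c c0 cE] := IH _ _; first by move=> j jl; apply: gl; right.
by exists (a + c); [exact: addr_gt0|rewrite big_cons aE cE mulrDl].
Qed.

End ShiftOperators.

Lemma subrBACA (A : zmodType) (x y z t : A) : (x - y - (z - t) = x - z - (y - t))%R.
Proof. by rewrite !opprD !opprK addrACA. Qed.

(** * Consequences of Zorn's lemma *)

(** [C] is maximal by Zorn; if it misses both [v] and [- v], adjoining either one produces 0, and
    commutativity makes the two relations contradictory. Injectivity of sums is asked only at the
    given [v], because the layers will sit inside larger modules of functions. *)
Lemma invariant_cone (A : zmodType) (Q : groupType) (T : Q -> A -> A) :
  (forall q v w, T q (v + w)%R = (T q v + T q w)%R) ->
  (forall v, T 1 v = v) ->
  (forall q r v, T (q * r) v = T q (T r v)) ->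
  (forall q r v, T q (T r v) = T r (T q v)) ->
  exists C : set A, [/\ ~ C 0%R,
    forall v w, C v -> C w -> C (v + w)%R,
    forall q v, C v -> C (T q v) &
    forall v,
      (forall l : seq Q, l <> [::] -> (\sum_(q <- l) T q v)%R = 0%R -> v = 0%R) ->
      [\/ C v, v = 0%R | C (- v)%R]].
Proof.
move=> TD T1 TM TC.
pose P (C : set A) := [/\ ~ C 0%R, forall v w, C v -> C w -> C (v + w)%R &
  forall q v, C v -> C (T q v)].
have [|C [[C0 CD CT] maxC]] := @Zorn_bigcup A P.
  move=> F FP Ftot; split=> [[B /FP[]]//|v w [B FB Bv] [B' FB' Bw]|q v [B FB Bv]].
  - have [BB'|B'B] := Ftot _ _ FB FB'.
    + by exists B' => //; have [_ BD _] := FP _ FB'; apply: BD => //; exact: BB'.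
    + by exists B => //; have [_ BD _] := FP _ FB; apply: BD => //; exact: B'B.
  - by exists B => //; have [_ _ BT] := FP _ FB; exact: BT.
exists C; split=> // v vreg.
have T0 q : T q 0%R = 0%R by apply: (addrI (T q 0%R)); rewrite -TD !addr0.
have TN q w : T q (- w)%R = (- T q w)%R.
  by apply: (addrI (T q w)); rewrite -TD !subrr T0.
pose act l w := (\sum_(q <- l) T q w)%R.
have actT q l w : T q (act l w) = act [seq q * r | r <- l] w.
  rewrite /act big_map (big_morph (T q) (TD q) (T0 q)).
  by apply: eq_bigr => r _; rewrite TM.
have actC l m w : act l (act m w) = act m (act l w).
  elim: l => [|q l IH]; first by rewrite /act !big_nil big1.
  rewrite {1}/act big_cons -/(act l _) IH /act.
  rewrite (big_morph (T q) (TD q) (T0 q)) -big_split /=.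
  by apply: eq_bigr => r _; rewrite big_cons TD TC.
have Cact l w : l <> [::] -> C w -> C (act l w).
  elim: l => // q l IH _ Cw; have [->|l0] := pselect (l = [::]).
    by rewrite /act big_seq1; exact: CT.
  by rewrite /act big_cons; apply: CD; [exact: CT|exact: IH].
(* The invariant cone generated by [C] and [w]; the second condition excludes the empty
   combination. *)
pose adj w : set A := [set u | exists c l,
  [/\ C c \/ c = 0%R, C c \/ l <> [::] & u = (c + act l w)%R]].
have adjP w : ~ C w -> adj w 0%R.
  move=> Cw; apply: contrapT => a0; apply: (maxC (adj w)).
    split=> [u Cu|]; first by exists u, [::]; rewrite /act big_nil addr0; split; auto.
    move=> /(_ w) h; apply/Cw/h; exists 0%R, [:: 1].
    by rewrite /act big_seq1 T1 add0r; split; auto; right.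
  split => // [u u' [c [l [cC cl ->]]] [c' [l' [cC' cl' ->]]]|q u [c [l [cC cl ->]]]].
    exists (c + c')%R, (l ++ l'); split; last by rewrite /act big_cat addrACA.
    - case: cC => [Cc|->]; last by rewrite add0r.
      by left; case: cC' => [Cc'|->]; [exact: CD|rewrite addr0].
    - case: cl => [Cc|l0]; last by right; case: (l) l0.
      by left; case: cC' => [Cc'|->]; [exact: CD|rewrite addr0].
  exists (T q c), [seq q * r | r <- l]; split; last by rewrite TD actT.
  - by case: cC => [Cc|->]; [left; exact: CT|right; exact: T0].
  - by case: cl => [Cc|l0]; [left; exact: CT|right; case: (l) l0].
have [|nCv] := pselect (C v); first by constructor 1.
have [|nCNv] := pselect (C (- v)%R); first by constructor 3.
constructor 2; apply: contrapT => v0.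
(* Here [0 = c + act l v = d - act m v], and [v <> 0] excludes [c = 0] and [d = 0]. So [- act l v]
   and [act m v] lie in [C]; applying [act m] and [act l] to them gives two opposite elements of
   [C]. *)
have [c [l [cC cl cE]]] := adjP _ nCv; have [d [m [dC dm dE]]] := adjP _ nCNv.
have actN k w : act k (- w)%R = (- act k w)%R.
  by rewrite /act -sumrN; apply: eq_bigr => q _; exact: TN.
have l0 : l <> [::].
  by move=> l0; case: cl => // Cc; apply: C0; rewrite cE l0 /act big_nil addr0.
have m0 : m <> [::].
  by move=> m0; case: dm => // Cd; apply: C0; rewrite dE m0 /act big_nil addr0.
have Cl : C (- act l v)%R.
  case: cC => [|c0]; first by move/esym/eqP: cE; rewrite addr_eq0 => /eqP->.
  by case: v0; apply: (vreg l) => //; rewrite [RHS]cE c0 add0r.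
have Cm : C (act m v).
  move/esym/eqP: dE; rewrite actN subr_eq0 => /eqP dE.
  case: dC => [|d0]; first by rewrite dE.
  by case: v0; apply: (vreg m) => //; rewrite -[LHS]dE.
apply: C0; rewrite -(addrN (act l (act m v))) {2}actC -actN.
by apply: CD; exact: Cact.
Qed.

Lemma pair_mulrz (A B : zmodType) (x : A) (y : B) (k : int) :
  ((x, y) *~ k = (x *~ k, y *~ k))%R.
Proof.
have nE n : ((x, y) *+ n = (x *+ n, y *+ n))%R.
  by elim: n => [//|n IH]; rewrite !mulrS IH.
by case: k => n; rewrite /intmul /= nE.
Qed.

(** Divisible groups are injective: partial functionals are encoded by their graphs, subgroups of
    [A * R], and a maximal graph is defined everywhere. *)
Lemma additive_extension (R : realFieldType) (A : zmodType) (B : set A) (a : A) :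
  B 0%R -> (forall x y, B x -> B y -> B (x - y)%R) ->
  (forall n, ~ B (a *+ n.+1)%R) ->
  exists f : A -> R, [/\ {morph f : x y / (x + y)%R},
    forall x, B x -> f x = 0%R & f a = 1%R].
Proof.
move=> B0 BB aB.
pose P (S : set (A * R)) := [/\ forall u v, S u -> S v -> S (u - v)%R,
  (forall x, B x -> S (x, 0%R)), S (a, 1%R) & forall r, S (0%R, r) -> r = 0%R].
(* The graph of [b + k a |-> k] on the subgroup generated by [B] and [a], single-valued by [aB]. *)
pose base : set (A * R) := [set u | exists k : int, B (u.1 - a *~ k)%R /\ u.2 = k%:~R%R].
have Pbase : P base.
  split.
  - move=> [x r] [y t] [k [/= Bx ->]] [l [/= By ->]]; exists (k - l)%R => /=.
    split; last by rewrite rmorphB.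
    by rewrite mulrzBr subrBACA; exact: BB.
  - by move=> x Bx; exists 0%R; rewrite /= mulr0z subr0.
  - by exists 1%R; rewrite /= mulr1z subrr.
  - move=> r [[k|k] [/=]]; last first.
      by rewrite NegzE mulrNz opprK add0r => /aB.
    rewrite sub0r => Bk ->; case: k Bk => // k Bk; case: (aB k).
    by have := BB _ _ B0 Bk; rewrite sub0r opprK.
(* The alternative [S = set0] accommodates the empty chain; [base] then shows that a maximal [S] is
   not empty. *)
have [|S [PS maxS]] := @Zorn_bigcup _ (fun S => S = set0 \/ P S).
  move=> F FP Ftot.
  have [[S0 [FS0 PS0]]|nP] := pselect (exists S, F S /\ P S); last first.
    left; rewrite -subset0 => u [S FS Su].
    by have [S0|PS] := FP _ FS; [rewrite S0 in Su|case: nP; exists S].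
  have FPP S u : F S -> S u -> P S by move=> /FP[->|].
  right; have [_ S0B S0a _] := PS0; split.
  - move=> u v [S FS Su] [S' FS' Sv]; have [SS'|S'S] := Ftot _ _ FS FS'.
    + by exists S' => //; have [SD _ _ _] := FPP _ _ FS' Sv; apply: SD => //; exact: SS'.
    + by exists S => //; have [SD _ _ _] := FPP _ _ FS Su; apply: SD => //; exact: S'S.
  - by move=> x Bx; exists S0 => //; exact: S0B.
  - by exists S0.
  - by move=> r [S FS Sr]; have [_ _ _] := FPP _ _ FS Sr; apply.
have {}PS : P S.
  case: PS => // S0; exfalso; apply: (maxS base); last by right.
  rewrite S0; split => [//|]; move=> /(_ (a, 1%R)); apply.
  by have [_ _] := Pbase.
have [SB SB0 Sa S0] := PS.
have S00 : S 0%R by exact: SB0.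
have SN u : S u -> S (- u)%R by move=> Su; rewrite -sub0r; exact: SB.
have SD u v : S u -> S v -> S (u + v)%R.
  by move=> Su Sv; rewrite -(opprK v); apply: SB => //; exact: SN.
have SZ u (k : int) : S u -> S (u *~ k)%R.
  move=> Su; have Sn n : S (u *+ n)%R.
    by elim: n => [//|n IH]; rewrite mulrS; exact: SD.
  by case: k => n; [exact: Sn|apply: SN; exact: Sn].
have Sfun x r t : S (x, r) -> S (x, t) -> r = t.
  move=> xr xt; have := SB _ _ xr xt.
  rewrite (_ : _ - _ = (0, r - t))%R; last by congr pair; rewrite /= subrr.
  by move=> /S0/eqP; rewrite subr_eq0 => /eqP.
have Stot x : exists r, S (x, r).
  apply: contrapT => nx.
  (* If a nonzero multiple [m x] already has a value [r], the value at [x] must be [r / m];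
     otherwise it is free and 0 is chosen. *)
  have [r0 r0P] : exists r0 : R, forall (k : int) t, S (x *~ k, t)%R -> t = (k%:~R * r0)%R.
    have [[m [m0 [r mr]]]|nm] :=
        pselect (exists m : int, m != 0%R /\ exists r, S (x *~ m, r)%R).
      exists (r / m%:~R)%R => k t kt.
      have mR : (m%:~R : R)%R != 0%R by rewrite intr_eq0.
      apply: (mulfI mR); rewrite (_ : _ * (_ * _) = k%:~R * r)%R; last by field.
      rewrite !mulrzl.
      apply: (Sfun (x *~ (k * m))%R).
        by have := SZ _ m kt; rewrite pair_mulrz -mulrzA.
      by have := SZ _ k mr; rewrite pair_mulrz -mulrzA mulrC.
    exists 0%R => k t kt; rewrite mulr0; have [k0|k0] := eqVneq k 0%R.
      by move: kt; rewrite k0 mulr0z => /S0.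
    by case: nm; exists k; split=> //; exists t.
  pose S' : set (A * R) := [set u | exists k : int, S (u - (x, r0) *~ k)%R].
  apply: (maxS S').
    split=> [u Su|]; first by exists 0%R; rewrite mulr0z subr0.
    move=> /(_ (x, r0)) xS; apply: nx; exists r0; apply: xS.
    by exists 1%R; rewrite mulr1z subrr.
  right; split.
  - move=> u v [k Su] [l Sv]; exists (k - l)%R.
    by rewrite mulrzBr subrBACA; exact: SB.
  - by move=> y By; exists 0%R; rewrite mulr0z subr0; exact: SB0.
  - by exists 0%R; rewrite mulr0z subr0.
  - move=> r [k /SN]; rewrite opprB.
    have -> : ((x, r0) *~ k - (0, r) = (x *~ k, k%:~R * r0 - r))%R.
      by rewrite pair_mulrz mulrzl; congr pair; rewrite /= subr0.
    by move=> /r0P/eqP; rewrite -subr_eq0 addrAC subrr sub0r oppr_eq0 => /eqP.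
have /choice[f fP] := Stot.
exists f; split.
- by move=> x y; apply: (Sfun (x + y)%R); [exact: fP|exact: (SD (x, _) (y, _))].
- by move=> x Bx; apply: (Sfun x); [exact: fP|exact: SB0].
- exact: (Sfun a).
Qed.

(** * Homomorphisms, commutator identities and subgroups *)

Section Multiplicative.
Variables (G H : groupType) (f : {multiplicative G -> H}).

Lemma multiplicative1 : f 1 = 1.
Proof. by apply: (mulgI (f 1)); rewrite -gmulfM !mulg1. Qed.

Lemma multiplicativeV x : f x^-1 = (f x)^-1.
Proof. by apply: (mulgI (f x)); rewrite -gmulfM !mulgV multiplicative1. Qed.

Lemma multiplicativeX x n : f (x ^+ n) = f x ^+ n.
Proof. by elim: n => [|n IH]; rewrite ?multiplicative1 // !expgS gmulfM IH. Qed.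

Lemma multiplicativeR x y : f [~ x, y] = [~ f x, f y].
Proof. by rewrite /commg /conjg !gmulfM !multiplicativeV. Qed.

End Multiplicative.

Lemma commMg (G : groupType) (x y z : G) : [~ x * y, z] = [~ x, z] ^ y * [~ y, z].
Proof. by rewrite /commg /conjg !invgM !mulgA !mulgK. Qed.

Lemma commgM (G : groupType) (x y z : G) : [~ x, y * z] = [~ x, z] * [~ x, y] ^ z.
Proof. by rewrite /commg /conjg !invgM !mulgA !mulgK. Qed.

Lemma conjg_commg (G : groupType) (x y : G) : x ^ y = x * [~ x, y].
Proof. by rewrite /commg mulgA mulgV mul1g. Qed.

Definition is_subgroup (G : groupType) (F : set G) :=
  [/\ F 1, forall x y, F x -> F y -> F (x * y) & forall x, F x -> F x^-1].

Lemma generated_sub (G : groupType) (A F : set G) :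
  is_subgroup F -> A `<=` F -> generated A `<=` F.
Proof.
move=> [F1 FM FV] AF x; elim=> {x} [x /AF||x y _ Fx _ Fy|x _ Fx] //; first exact: FM.
exact: FV.
Qed.

Lemma generated_subgroup (G : groupType) (A : set G) : is_subgroup (generated A).
Proof.
by split; [exact: generated1|exact: generatedM|exact: generatedV].
Qed.

Lemma subgroupX (G : groupType) (F : set G) x n : is_subgroup F -> F x -> F (x ^+ n).
Proof.
by move=> [F1 FM _] Fx; elim: n => // n IH; rewrite expgS; exact: FM.
Qed.

Lemma ab_pi1 (G : groupType) : ab_pi (1 : G) = 0%R.
Proof. by []. Qed.

Lemma ab_piV (G : groupType) (x : G) : ab_pi x^-1 = (- ab_pi x)%R.
Proof. by apply: (addrI (ab_pi x)); rewrite -ab_piM mulgV subrr ab_pi1. Qed.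

Lemma ab_piX (G : groupType) (x : G) n : ab_pi (x ^+ n) = (ab_pi x *+ n)%R.
Proof.
by elim: n => [|n IH]; [exact: ab_pi1|rewrite expgS mulrS -IH ab_piM].
Qed.

Section SubgroupPred.
Variables (G : groupType) (F : set G) (FS : is_subgroup F).

(** The proof of [is_subgroup F] is an argument so that the closure instances can be attached to the
    predicate. *)
Definition subgroup_pred of is_subgroup F : {pred G} := fun x => `[< F x >].

Local Notation P := (subgroup_pred FS).

Lemma subgroup_predP x : reflect (F x) (x \in P).
Proof. exact: asboolP. Qed.

Lemma subgroup_pred_mul : mulg_closed P.
Proof.
by have [_ FM _] := FS; move=> x y /subgroup_predP Fx /subgroup_predP Fy; apply/subgroup_predP/FM.
Qed.

Lemma subgroup_pred_one : 1 \in P.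
Proof. by have [F1 _ _] := FS; exact/subgroup_predP. Qed.

Lemma subgroup_pred_inv : invg_closed P.
Proof.
by have [_ _ FV] := FS; move=> x /subgroup_predP Fx; apply/subgroup_predP/FV.
Qed.

HB.instance Definition _ := isMulClosed.Build G P subgroup_pred_mul.
HB.instance Definition _ := isMul1Closed.Build G P subgroup_pred_one.
HB.instance Definition _ := isInvClosed.Build G P subgroup_pred_inv.

End SubgroupPred.

(** * Central functionals and the real lower central series *)

Section CentralHom.
Variables (R : realType) (H : groupType).

(** For a normal subgroup [F] these are the homomorphisms from [F / [F, H]] to the reals, written as
    functions on all of [H] with arbitrary values off [F]. *)
Definition central_hom (F : set H) (phi : H -> R) :=
  (forall x y, F x -> F y -> phi (x * y) = (phi x + phi y)%R) /\
  (forall x k, F x -> phi [~ x, k] = 0%R).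

Variables (F : set H) (FS : is_subgroup F).
Hypothesis FR : forall x k, F x -> F [~ x, k].

Lemma central_hom1 phi : central_hom F phi -> phi 1 = 0%R.
Proof.
have [F1 _ _] := FS; move=> [hM _].
by apply: (addrI (phi 1)); rewrite -hM // mulg1 addr0.
Qed.

Lemma central_homV phi x : central_hom F phi -> F x -> phi x^-1 = (- phi x)%R.
Proof.
have [_ _ FV] := FS; move=> hphi Fx; have [hM _] := hphi.
apply: (addrI (phi x)); rewrite -hM //; last exact: FV.
by rewrite mulgV subrr central_hom1.
Qed.

Lemma central_homX phi x n : central_hom F phi -> F x -> phi (x ^+ n) = (phi x *+ n)%R.
Proof.
move=> hphi Fx; elim: n => [|n IH]; first by rewrite central_hom1.
by rewrite expgS hphi.1 ?IH ?mulrS //; exact: subgroupX.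
Qed.

Lemma central_homJ phi x y : central_hom F phi -> F x -> phi (x ^ y) = phi x.
Proof.
move=> [hM hR] Fx; rewrite conjg_commg hM ?hR ?addr0 //; exact: FR.
Qed.

Lemma central_hom_shift_subs (f : {multiplicative H -> H}) s phi :
  (forall x, F x -> F (f x)) -> central_hom F phi ->
  central_hom F (shift_subs f s phi).
Proof.
move=> Ff hphi; elim: s => //= a s [hM hR]; split=> [x y Fx Fy|x k Fx].
  by rewrite /shift_sub gmulfM !hM ?mulrDr ?opprD 1?addrACA //; exact: Ff.
by rewrite /shift_sub multiplicativeR !hR ?mulr0 ?subr0 //; exact: Ff.
Qed.

(** If no positive power of [x] lies in [[F, H]], then [x] has infinite order in the abelianization
    of [F] modulo the image of [[F, H]], and [additive_extension] gives a functional with value 1 at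
    [x]. *)
Lemma central_hom_sep x : F x ->
  (forall phi, central_hom F phi -> phi x = 0%R) ->
  exists n, generated [set [~ y, k] | y in F & k in [set: H]] (x ^+ n.+1).
Proof.
set N := generated _ => Fx x0; apply: contrapT => xN.
have [F1 FM FV] := FS; have NS : is_subgroup N := generated_subgroup _.
have [N1 NM NV] := NS.
pose P := subgroup_pred FS; pose A := abelianization (subg P).
have PF (u : subg P) : F (val u) by exact/(subgroup_predP FS)/subg_valP.
have derN u : u \in derived (subg P) -> N (val u).
  move=> /derivedP; elim=> {u} [_ [y _ [z _ <-]]||u v _ Nu _ Nv|u _ Nu].
  - by rewrite gmulfR; apply: generated_in; exists (val y) => //; exists (val z).
  - by rewrite gmulf1.
  - by rewrite gmulfM; exact: NM.
  - by rewrite gmulfV; exact: NV.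
pose B : set A := [set ab_pi u | u in [set u : subg P | N (val u)]].
pose sub y (Fy : F y) : subg P := @Subg _ _ y (introT (subgroup_predP FS y) Fy).
have [||n [u /= Nu]|f [fD fB fx]] :=
    @additive_extension R A B (ab_pi (sub x Fx)).
- by exists 1; rewrite /= ?gmulf1 //; exact: ab_pi1.
- move=> _ _ [u /= Nu <-] [v /= Nv <-]; exists (u * v^-1).
    suff : N (val (u * v^-1)) by [].
    by rewrite gmulfM gmulfV; apply: NM => //; exact: NV.
  by rewrite ab_piM ab_piV.
- rewrite -ab_piX => /ab_pi_eqP/derN.
  rewrite gmulfM gmulfV => Nd; apply: xN; exists n.
  have -> : x ^+ n.+1 = val u * ((val u)^-1 * val (sub x Fx ^+ n.+1)).
    by rewrite mulgA mulgV mul1g multiplicativeX.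
  exact: NM.
(* The value 0 off [F] is only a default. *)
pose phi y := if pselect (F y) is left Fy then f (ab_pi (sub y Fy)) else 0%R.
have phiE y (Fy : F y) : phi y = f (ab_pi (sub y Fy)).
  by rewrite /phi; case: pselect => // Fy'; congr (f (ab_pi _)); exact: val_inj.
suff /x0 : central_hom F phi.
  by rewrite (phiE x Fx) fx => /eqP; rewrite oner_eq0.
split=> [y z Fy Fz|y k Fy].
  rewrite (phiE y Fy) (phiE z Fz) (phiE _ (FM _ _ Fy Fz)) -fD -ab_piM.
  by congr (f (ab_pi _)); exact: val_inj.
rewrite (phiE _ (FR k Fy)); apply: fB; exists (sub _ (FR k Fy)) => //=.
by apply: generated_in; exists y => //; exists k.
Qed.

End CentralHom.

Section RealLowerCentral.
Variables (R : realType) (H : groupType).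

Fixpoint real_lcs (n : nat) : set H :=
  if n is m.+1 then
    [set x | real_lcs m x /\
             forall phi : H -> R, central_hom (real_lcs m) phi -> phi x = 0%R]
  else [set: H].

Lemma real_lcs_subgroup n : is_subgroup (real_lcs n).
Proof.
elim: n => [|n IH]; first by split.
have [F1 FM FV] := IH; split=> [|x y [Fx x0] [Fy y0]|x [Fx x0]] /=.
- by split=> // phi hphi; exact: (central_hom1 IH hphi).
- split=> [|phi hphi]; first exact: FM.
  by rewrite hphi.1 // x0 // y0 // addr0.
- split=> [|phi hphi]; first exact: FV.
  by rewrite (central_homV IH hphi Fx) x0 // oppr0.
Qed.

Lemma real_lcs_comm n x k : real_lcs n x -> real_lcs n.+1 [~ x, k].
Proof.
elim: n x k => [|n IH] x k Fx; split=> [|phi [_ hR]]; rewrite ?hR //.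
exact: IH Fx.1.
Qed.

Lemma real_lcsS n : real_lcs n.+1 `<=` real_lcs n.
Proof. by move=> x []. Qed.

Lemma real_lcsR n x k : real_lcs n x -> real_lcs n [~ x, k].
Proof. by move=> /real_lcs_comm-/(_ k)/real_lcsS. Qed.

Lemma real_lcs_mono m n : m <= n -> real_lcs n `<=` real_lcs m.
Proof.
elim: n => [|n IH]; first by rewrite leqn0 => /eqP->.
by rewrite leq_eqVlt => /orP[/eqP->//|/IH mn] x /real_lcsS/mn.
Qed.

Lemma real_lcs_morph (f : {multiplicative H -> H}) n x :
  real_lcs n x -> real_lcs n (f x).
Proof.
elim: n x => // n IH x [Fx x0]; split=> [|phi [hM hR]]; first exact: IH.
apply: (x0 (phi \o f)); split=> [y z Fy Fz|y k Fy] /=.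
  by rewrite gmulfM hM //; exact: IH.
by rewrite multiplicativeR hR //; exact: IH.
Qed.

(** A basis-free form of positivity of the eigenvalues of [phi |-> phi \o f] on layer [n]; one list
    [s] serves all functionals. *)
Definition positive_roots (f : H -> H) (n : nat) := exists2 s : seq R,
  all (fun a => 0 < a)%R s & forall phi, central_hom (real_lcs n) phi ->
  forall x, real_lcs n x -> shift_subs f s phi x = 0%R.

(* [phi |-> ((x, k) |-> phi [~ x, k])] embeds the functionals on layer [n.+1]
   equivariantly into the tensor product of those on layers [n] and [0]. *)
Lemma positive_rootsS (f : {multiplicative H -> H}) n :
  positive_roots f 0 -> positive_roots f n -> positive_roots f n.+1.
Proof.
move=> [s0 s0_gt0 s0P] [s s_gt0 sP].
have morf m x : real_lcs m x -> real_lcs m (f x) := @real_lcs_morph f m x.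
pose u := [seq a * b | a <- s, b <- s0]%R; exists u.
  apply/allP => c /allpairsP[[a b] [/= /(allP s_gt0) a0 /(allP s0_gt0) b0 ->]].
  exact: mulr_gt0.
move=> phi hphi.
have FS := real_lcs_subgroup n; have FS1 := real_lcs_subgroup n.+1.
set psi := shift_subs f u phi.
have hpsi : central_hom (real_lcs n.+1) psi.
  by apply: central_hom_shift_subs => // x; exact: morf.
(* Vanishing on commutators suffices: by [central_hom_sep] a positive power of each [x] in the layer
   lies in the subgroup they generate, and the reals are torsion-free. *)
suff psi0 x k : real_lcs n x -> psi [~ x, k] = 0%R.
  move=> x [Fx x0].
  have [m] := central_hom_sep FS (@real_lcsR n) Fx x0; set N := generated _.
  suff NK : N `<=` [set y | real_lcs n.+1 y /\ psi y = 0%R].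
    move=> /NK[_]; rewrite (central_homX FS1 _ hpsi) // => /eqP.
    by rewrite mulrn_eq0 => /eqP.
  apply: generated_sub => [|_ [y Fy [k _ <-]]]; last first.
    by split; [exact: real_lcs_comm|exact: psi0].
  have [F1 FM FV] := FS1; split=> [|y z [Fy y0] [Fz z0]|y [Fy y0]].
  - by split; [|exact: (central_hom1 FS1 hpsi)].
  - by split; [exact: FM|rewrite hpsi.1 // y0 z0 addr0].
  - by split; [exact: FV|rewrite (central_homV FS1 hpsi Fy) y0 oppr0].
move=> Fx.
have iterF m j y : real_lcs m y -> real_lcs m (iter j f y).
  by move=> Fy; elim: j => //= j; exact: morf.
(* Exponents separate the two arguments of the commutator: [sigma] and [tau] apply [f] to one
   argument each and commute, while [sigma \o tau] applies [f] to the whole commutator. *)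
pose i (p : nat * nat) := [~ iter p.1 f x, iter p.2 f k].
pose sigma (p : nat * nat) := (p.1.+1, p.2).
pose tau (p : nat * nat) := (p.1, p.2.+1).
have phiJ y z : real_lcs n.+1 y -> phi (y ^ z) = phi y.
  exact: (central_homJ (@real_lcsR n.+1)).
have comF y z : real_lcs n y -> real_lcs n.+1 [~ y, z] := @real_lcs_comm n y z.
have -> : psi [~ x, k] = shift_subs (sigma \o tau) u (phi \o i) (0, 0).
  by rewrite (@shift_subs_comp _ _ _ _ f) // => -[a b]; rewrite multiplicativeR.
rewrite shift_subs_allpairs //; apply/funext => -[a b].
(* For fixed [b], [y |-> phi [~ y, iter b f k]] is a central functional on layer [n]. *)
- rewrite -[LHS]/((shift_subs sigma s (phi \o i) \o (fun a => (a, b))) a).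
  rewrite -(@shift_subs_comp _ _ _ S _ (fun a => (a, b))) //.
  rewrite -[X in shift_subs _ _ X]/((fun y => phi [~ y, iter b f k]) \o (fun a => iter a f x)).
  rewrite (@shift_subs_comp _ _ _ S f) //=; apply: sP; last exact: iterF.
  have [hM hR] := hphi; split=> [y z Fy Fz|y z Fy].
    rewrite commMg hM; first by rewrite phiJ //; exact: comF.
      rewrite conjg_commg; have [_ FM _] := FS1.
      by apply: FM; [|apply: real_lcsR]; exact: comF.
    exact: comF.
  by rewrite hR //; exact: comF.
(* For fixed [a], [y |-> phi [~ iter a f x, y]] is a homomorphism on all of [H]; it kills
   commutators because its target is abelian. *)
- rewrite -[LHS]/((shift_subs tau s0 (phi \o i) \o (fun b => (a, b))) b).
  rewrite -(@shift_subs_comp _ _ _ S _ (fun b => (a, b))) //.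
  rewrite -[X in shift_subs _ _ X]/((fun y => phi [~ iter a f x, y]) \o (fun b => iter b f k)).
  rewrite (@shift_subs_comp _ _ _ S f) //=; apply: s0P => //.
  have Fa : real_lcs n (iter a f x) by exact: iterF.
  have homa y z : phi [~ iter a f x, y * z] =
      (phi [~ iter a f x, y] + phi [~ iter a f x, z])%R.
    rewrite commgM hphi.1; first by rewrite phiJ; [exact: addrC|exact: comF].
      exact: comF.
    rewrite conjg_commg; have [_ FM _] := FS1.
    by apply: FM; [|apply: real_lcsR]; exact: comF.
  split=> [y z _ _|y z _]; first exact: homa.
  have : phi [~ iter a f x, z * y * [~ y, z]] = phi [~ iter a f x, y * z].
    by rewrite -commgC.
  by rewrite !homa [X in (X + _)%R]addrC => /eqP; rewrite -subr_eq0 addrAC subrr add0r => /eqP.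
Qed.

End RealLowerCentral.

(** * Torsion-free nilpotent quotients *)

Section UpperCentral.
Variable N : groupType.

Fixpoint upper_central (n : nat) : set N :=
  if n is m.+1 then [set x | forall y, upper_central m [~ x, y]] else [set 1].

Lemma upper_central_normal n : is_subgroup (upper_central n) /\
  forall x y, upper_central n x -> upper_central n (x ^ y).
Proof.
elim: n => [|n [[Z1 ZM ZV] ZJ]].
  split; first by split=> //= [x y -> ->|x ->]; rewrite ?mulg1 ?invg1.
  by move=> x y /= ->; rewrite conj1g.
split; first split.
- by move=> y; rewrite comm1g.
- by move=> x y Zx Zy z; rewrite commMg; apply: ZM; [apply: ZJ; exact: Zx|exact: Zy].
- move=> x Zx y.
  have -> : [~ x^-1, y] = ([~ x, y]^-1) ^ x^-1.
    by rewrite /commg /conjg !invgM !invgK !mulgA !mulgK.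
  by apply: ZJ; apply: ZV; exact: Zx.
- move=> x y Zx z.
  by rewrite -(conjgKV y z) -conjRg; apply: ZJ; exact: Zx.
Qed.

Lemma upper_centralS n : upper_central n `<=` upper_central n.+1.
Proof.
have [[Z1 ZM ZV] ZJ] := upper_central_normal n.
move=> x Zx y; rewrite /commg; apply: ZM; [exact: ZV|exact: ZJ].
Qed.

Lemma nilpotent_upper_central :
  nilpotent_group N -> exists c, upper_central c = [set: N].
Proof.
move=> [c Nc]; exists c; rewrite -subTset.
suff h i : i <= c -> lower_central N (c - i) `<=` upper_central i.
  by have := h c (leqnn c); rewrite subnn.
elim: i => [|i IH] ic; first by rewrite subn0.
move=> x Nx y; apply: IH; first exact: ltnW.
by rewrite -subSS subSn //; apply: generated_in; exists x => //; exists y.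
Qed.

Hypothesis tfN : torsion_free N.

(** Commutation with [y] takes powers of [x] to powers of [[~ x, y]] modulo a smaller term, so
    torsion in one upper central quotient descends to the previous one and finally to [N]. *)
Lemma upper_central_root_step n x k :
  upper_central n.+1 x -> upper_central n (x ^+ k.+1) -> upper_central n x.
Proof.
elim: n x => [|n IH] x Zx Zxk; first exact: tfN Zxk.
have [[Z1 ZM ZV] ZJ] := upper_central_normal n.
move=> y; apply: IH; first exact: Zx.
(* [[~ x, y]] lies in [upper_central n.+1], hence is central modulo [upper_central n]. *)
have H j : upper_central n ([~ x ^+ j, y]^-1 * [~ x, y] ^+ j).
  elim: j => [|j IHj]; first by rewrite comm1g mulg1 invg1.
  rewrite [x ^+ _]expgS commMg invgM expgS.
  set c := [~ x, y]; set d := [~ x ^+ j, y].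
  have dE a z : d^-1 * a^-1 * (c * z) = (a^-1 * c) ^ d * (d^-1 * z).
    by move: c d => c' d'; rewrite /conjg -!mulgA mulVKg.
  rewrite dE.
  apply: ZM => //; apply: ZJ; rewrite conjg_commg invgM mulgVK.
  by apply: ZV; exact: Zx.
rewrite -[X in upper_central n X](mulVKg [~ x ^+ k.+1, y]).
by apply: ZM; [exact: Zxk|exact: H].
Qed.

(** [x] lies in [upper_central (n + c)], from where [upper_central_root_step] descends one term at a
    time. *)
Lemma upper_central_root c n x k : upper_central c = [set: N] ->
  upper_central n (x ^+ k.+1) -> upper_central n x.
Proof.
move=> Zc Zxk.
have up m : upper_central (n + m) (x ^+ k.+1).
  by elim: m => [|m IH]; rewrite ?addn0 ?addnS //; exact: upper_centralS.
have top m : upper_central (m + c) x.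
  by elim: m => [|m IH]; [rewrite Zc|exact: upper_centralS].
have {top} := top n.
elim: c {Zc} => [|m IH]; first by rewrite addn0.
by rewrite addnS => Zx; apply: IH; exact: upper_central_root_step (up m).
Qed.

End UpperCentral.

(** A homomorphism [f] to [N] sends [real_lcs n] into [upper_central (c - n)]: commutators drop one
    term, and the root left by [central_hom_sep] is absorbed since upper central terms of [N] are
    closed under roots. *)
Lemma real_lcs_bigcap (R : realType) (H : groupType) (x : H) :
  residually_torsion_free_nilpotent H -> (forall n, real_lcs R n x) -> x = 1.
Proof.
move=> resH Fx; apply: contrapT => /resH[N [f [nilN tfN fx]]].
have [c Zc] := nilpotent_upper_central nilN; apply: fx.
suff h n y : n <= c -> real_lcs R n y -> @upper_central N (c - n) (f y).
  by have := h c x (leqnn c) (Fx c); rewrite subnn.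
elim: n y => [|n IH] y nc; first by rewrite subn0 Zc.
move=> [Fy y0].
have [m] := central_hom_sep (real_lcs_subgroup R H n) (@real_lcsR R H n) Fy y0.
set B := generated _ => By.
apply: (upper_central_root tfN (k := m) Zc); rewrite -multiplicativeX.
have [[Z1 ZM ZV] ZJ] := upper_central_normal N (c - n.+1).
suff : B `<=` [set z | @upper_central N (c - n.+1) (f z)] by apply.
apply: generated_sub => [|_ [z Fz [k _ <-]]].
  split=> [|z t Zz Zt|z Zz]; rewrite /= ?multiplicative1 ?gmulfM ?multiplicativeV //.
    exact: ZM.
  exact: ZV.
have := IH z (ltnW nc) Fz; rewrite subnS; case: (c - n)%N (subn_gt0 n c) => [|d _].
  by rewrite nc.
by move=> /(_ (f k)); rewrite /= multiplicativeR.
Qed.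

(** * The action on the abelianization *)

Lemma real_positive_roots (R : realType) (p : {poly R}) : p \is monic ->
  (forall z : R[i], root (map_poly (real_complex R) p) z ->
     exists2 x : R, (0 < x)%R & z = real_complex R x) ->
  exists2 s : seq R, all (fun a => 0 < a)%R s & p = (\prod_(a <- s) ('X - a%:P))%R.
Proof.
move=> pm proots; set q := map_poly _ _ in proots.
have [r qE] := closed_field_poly_normal q.
have qm : q \is monic by rewrite map_monic.
rewrite (monicP qm) scale1r in qE.
have [s s0 rE] : exists2 s : seq R, all (fun a => 0 < a)%R s & r = map (real_complex R) s.
  have : forall z, z \in r -> root q z by move=> z zr; rewrite qE root_prod_XsubC.
  elim: {qE} r => [|z r IH] rr; first by exists [::].
  have [|s s0 ->] := IH; first by move=> y yr; apply: rr; rewrite inE yr orbT.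
  have [|x x0 ->] := proots z; first by apply: rr; rewrite mem_head.
  by exists (x :: s) => //=; rewrite x0.
exists s => //; apply: (map_poly_inj (real_complex R)).
rewrite -/q qE rE big_map rmorph_prod; apply: eq_bigr => a _ /=.
by rewrite map_polyXsubC.
Qed.

(** Cayley-Hamilton: the characteristic polynomial splits as the product of ['X - a] over [s], and
    in coordinates a functional is [c |-> c L], so the operators turn it into
    [c |-> c chi(A) L = 0]. *)
Lemma eigenvalues_positive_roots (R : realType) (V : lmodType R) (T : {linear V -> V}) :
  finite_dimensional V -> eigenvalues_positive T ->
  exists2 s : seq R, all (fun a => 0 < a)%R s &
    forall l : {scalar V}, shift_subs T s l = fun=> 0%R.
Proof.
move=> [n [b bP]] Tpos.
have [A AP] : exists A : 'M[R]_n, matrix_in_basis T b A.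
  have /choice[c cP] : forall i, exists c : 'rV[R]_n, (T (b i) = \sum_j c 0 j *: b j)%R.
    by move=> i; have [c [cE _]] := bP (T (b i)); exists c.
  exists (\matrix_(i, j) c i 0 j)%R => i; rewrite cP.
  by apply: eq_bigr => j _; rewrite mxE.
have [s s0 sE] := real_positive_roots (char_poly_monic A) (Tpos n b A bP AP).
exists s => // l.
pose vec (c : 'rV[R]_n) := (\sum_i c 0 i *: b i)%R.
pose L := (\col_i l (b i))%R : 'cV[R]_n.
have vecT c : vec (c *m A)%R = T (vec c).
  rewrite /vec linear_sum /=.
  under [RHS]eq_bigr do rewrite linearZ /= AP scaler_sumr.
  rewrite exchange_big /=; apply: eq_bigr => j _.
  by rewrite mxE scaler_suml; apply: eq_bigr => i _; rewrite scalerA.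
have lvec : l \o vec = fun c => (c *m L)%R 0%R 0%R.
  apply/funext => c; rewrite /vec /= linear_sum mxE; apply: eq_bigr => i _.
  by rewrite linearZ mxE.
apply: funext => v; have [c [-> _]] := bP v.
rewrite -[LHS]/((shift_subs T s l \o vec) c) -(shift_subs_comp _ _ vecT) lvec.
(* Dimension 0 is treated apart because [horner_mx] requires a nonzero matrix size. *)
case: n => [|n] in b bP A AP sE vec L vecT lvec c *.
  have -> : (fun c : 'rV_0 => (c *m L)%R 0%R 0%R) = (fun=> 0%R).
    by apply/funext => d; rewrite mxE big_ord0.
  by rewrite shift_subs0.
suff -> : shift_subs (fun c => c *m A)%R s (fun c : 'rV_n.+1 => (c *m L) 0 0)%R =
    (fun c => (c *m horner_mx A (\prod_(a <- s) ('X - a%:P)) *m L) 0 0)%R.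
  by rewrite -sE Cayley_Hamilton mulmx0 mul0mx mxE.
elim: (s) => [|a u IH] /=; apply/funext => d.
  by rewrite big_nil rmorph1 mulmx1.
rewrite IH /shift_sub big_cons rmorphM rmorphB /= horner_mx_X horner_mx_C.
rewrite -mulmxE mulmxA mulmxBr mulmxBl mulmxBl mul_mx_scalar -!scalemxAl.
by rewrite !mxE.
Qed.

Lemma tensor_fun_ext (M : zmodType) (R : nzRingType) (A : zmodType)
    (f g : tensor M R -> A) :
  {morph f : t u / (t - u)%R} -> {morph g : t u / (t - u)%R} ->
  (forall m r, f (tens m r) = g (tens m r)) -> f =1 g.
Proof.
move=> fB gB; pose fA := GRing.isZmodMorphism.Build _ _ f fB.
pose gA := GRing.isZmodMorphism.Build _ _ g gB.
pose F : {additive tensor M R -> A} := HB.pack f fA.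
pose G : {additive tensor M R -> A} := HB.pack g gA.
exact: (@tensor_additive_ext M R A F G).
Qed.

(** Two universal properties: [phi] kills the derived subgroup, so it induces [psi] on the
    abelianization, and [(a, r) |-> r * psi a] is biadditive. *)
Lemma tensor_functional (R : realType) (H : groupType) (phi : H -> R) :
  (forall x y, phi (x * y) = (phi x + phi y)%R) ->
  exists l : {scalar tensor (abelianization H) R},
    forall x r, l (tens (ab_pi x) r) = (r * phi x)%R.
Proof.
move=> phiM.
have phi1 : phi 1 = 0%R by apply: (addrI (phi 1)); rewrite -phiM mulg1 addr0.
have phiV x : phi x^-1 = (- phi x)%R.
  by apply: (addrI (phi x)); rewrite -phiM mulgV subrr.
have phid x : x \in derived H -> phi x = 0%R.
  move=> /derivedP; elim=> {x} [_ [y _ [z _ <-]]||x y _ x0 _ y0|x _ x0] //.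
  - by rewrite /commg /conjg !phiM !phiV; ring.
  - by rewrite phiM x0 y0 addr0.
  - by rewrite phiV x0 oppr0.
pose psi (a : abelianization H) := phi (repr (a : quotg (derived H))).
have psiE x : psi (ab_pi x) = phi x.
  have := phid _ (quotg_reprP (derived H) x).
  by rewrite phiM phiV => /eqP; rewrite addrC subr_eq0 => /eqP.
have psiD a b : psi (a + b)%R = (psi a + psi b)%R.
  have [x ->] := ab_pi_surj a; have [y ->] := ab_pi_surj b.
  by rewrite -ab_piM !psiE.
pose l0 : {freeg (abelianization H * R) / int} -> zmodule R :=
  fglift (fun p => (p.2 * psi p.1)%R : zmodule R).
have l0B : {morph l0 : u v / (u - v)%R} := lift_is_additive _.
have l0E a r : l0 << (a, r) >>%R = (r * psi a)%R by rewrite /l0 liftU scale1r.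
have l0_rel u : tensor_rel u -> l0 u = 0%R.
  elim=> {u} [a b r|a r t||u v _ u0 _ v0].
  - by rewrite !l0B !l0E psiD; ring.
  - by rewrite !l0B !l0E; ring.
  - by rewrite -(subrr 0%R) l0B subrr.
  - by rewrite l0B u0 v0 subrr.
pose l (t : tensor (abelianization H) R) : R := l0 (repr t).
have l_pi u : l (tensor_pi u) = l0 u.
  apply/eqP; rewrite -subr_eq0; apply/eqP; rewrite -[LHS]l0B.
  by apply: l0_rel; apply/tensor_pi_eqP; rewrite /tensor_pi reprK.
have lB : {morph l : t u / (t - u)%R}.
  move=> t u; have [a ->] := tensor_pi_surj t; have [b ->] := tensor_pi_surj u.
  by rewrite -raddfB !l_pi; exact: l0B.
pose lA := GRing.isZmodMorphism.Build _ _ l lB.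
have lE a r : l (tens a r) = (r * psi a)%R by rewrite l_pi l0E.
have lZ : scalable_for *%R l.
  move=> c; apply: tensor_fun_ext => [t u|t u|a r].
  - by rewrite scalerBr lB.
  - by rewrite lB mulrBr.
  - by rewrite tens_scale !lE mulrA.
pose lS := GRing.isScalable.Build _ _ _ _ l lZ.
pose ls : {scalar tensor (abelianization H) R} := HB.pack l lA lS.
exists ls => x r.
by rewrite /= lE psiE.
Qed.

(** Every functional on layer 0 is the pullback of a linear form along the equivariant map
    [x |-> x (x) 1]. *)
Lemma positive_roots0 (R : realType) (G : groupType) (K : normalClosed G) (g : G) :
  finite_dimensional (ab_tensor K R) ->
  eigenvalues_positive (conj_action K R g) ->
  positive_roots R (conj_sub g : subg K -> subg K) 0.
Proof.
move=> fdV gpos.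
pose T : {linear ab_tensor K R -> ab_tensor K R} := base_change R (ab_map (conj_sub g)).
have [s s0 sP] := @eigenvalues_positive_roots R _ T fdV gpos.
exists s => // phi [phiM _] x _.
have [l lE] := tensor_functional (fun x y => phiM x y I I).
pose i (x : subg K) : ab_tensor K R := tens (ab_pi x) 1%R.
have phiE : phi = l \o i by apply/funext => y; rewrite /= lE mul1r.
rewrite phiE (@shift_subs_comp _ _ _ _ T) ?sP // => y.
by rewrite /i -conj_actionE.
Qed.

(** * Invariant orders on the layers *)

Section Layers.
Variables (R : realType) (G : groupType) (K : normalClosed G).
Local Notation H := (subg K).
Local Notation F := (@real_lcs R H).

Lemma conj_sub1 (x : H) : conj_sub 1 x = x.
Proof. by apply: val_inj; rewrite conj_subE invg1 mulg1 mul1g. Qed.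

Lemma conj_subM (g h : G) (x : H) : conj_sub (g * h) x = conj_sub g (conj_sub h x).
Proof. by apply: val_inj; rewrite !conj_subE invgM !mulgA. Qed.

Lemma central_hom_conj_sub n (phi : H -> R) g :
  central_hom (F n) phi -> central_hom (F n) (phi \o conj_sub g).
Proof.
have Fg x : F n x -> F n (conj_sub g x) := @real_lcs_morph R _ (conj_sub g) n x.
move=> [hM hR]; split=> [x y Fx Fy|x k Fx] /=.
  by rewrite gmulfM hM //; exact: Fg.
by rewrite multiplicativeR hR //; exact: Fg.
Qed.

(** Changing [g] within its coset of [K] composes with an inner automorphism of [K], which central
    functionals do not see. *)
Lemma central_hom_coset n (phi : H -> R) g h x :
  central_hom (F n) phi -> F n x -> quotg_pi K g = quotg_pi K h ->
  phi (conj_sub g x) = phi (conj_sub h x).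
Proof.
move=> hphi Fx /quotg_eqP Kgh; pose k : H := Subg Kgh.
have -> : conj_sub h x = conj_sub g (x ^ k^-1).
  rewrite -[h](mulVKg g) conj_subM; congr conj_sub; apply: val_inj.
  by rewrite conj_subE /conjg invgK mulgA.
rewrite -[RHS]/((phi \o conj_sub g) _).
by rewrite (central_homJ (@real_lcsR R H n) _ (central_hom_conj_sub g hphi) Fx).
Qed.

Hypothesis QC : forall q r : quotg K, q * r = r * q.

(** [ev] embeds layer [n] into the functions [Q -> D -> R], with kernel [real_lcs n.+1]; conjugation
    becomes translation by [Q], and [P] is the preimage of an invariant cone there. *)
Lemma layer_cone n :
  (forall g, positive_roots R (conj_sub g : H -> H) n) ->
  exists P : set H, [/\
    forall x y, F n x -> F n y -> P x -> P y -> P (x * y),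
    forall x y, F n x -> F n.+1 y -> P x -> P (x * y) /\ P (y * x),
    forall g x, F n x -> P x -> P (conj_sub g x),
    forall x, F n.+1 x -> ~ P x &
    forall x, F n x -> [\/ P x, F n.+1 x | P x^-1]].
Proof.
move=> proots; pose Q := quotg K.
pose D := {phi : H -> R | central_hom (F n) phi}.
have FS := real_lcs_subgroup R H n; have [F1 FM FV] := FS.
pose ev (x : H) : Q -> D -> R := fun q d => sval d (conj_sub (repr q) x).
pose T (q : Q) (v : Q -> D -> R) : Q -> D -> R := fun r d => v (r * q) d.
have evE g x (d : D) : F n x -> ev x (quotg_pi K g) d = sval d (conj_sub g x).
  move=> Fx; apply: (@central_hom_coset n) => //; first exact: (svalP d).
  exact: reprK.
have repr_pi (q : Q) : q = quotg_pi K (repr q) by exact/esym/reprK.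
have evT g x : F n x -> ev (conj_sub g x) = T (quotg_pi K g) (ev x).
  move=> Fx; apply/funext => q; apply/funext => d.
  by rewrite /T {2}(repr_pi q) -gmulfM evE // conj_subM.
have FJ g x : F n x -> F n (conj_sub g x) := @real_lcs_morph R _ (conj_sub g) n x.
have evM x y : F n x -> F n y -> ev (x * y) = (ev x + ev y)%R.
  move=> Fx Fy; apply/funext => q; apply/funext => d.
  by rewrite /ev gmulfM (svalP d).1 //; exact: FJ.
have ev0 x : F n.+1 x -> ev x = 0%R.
  move=> Fx; apply/funext => q; apply/funext => d.
  have [_] := @real_lcs_morph R _ (conj_sub (repr q)) n.+1 x Fx.
  by apply; exact: (svalP d).
have evV x : F n x -> ev x^-1 = (- ev x)%R.
  move=> Fx; apply: (addrI (ev x)); rewrite -evM //; last exact: FV.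
  by rewrite mulgV subrr ev0 //; have [] := real_lcs_subgroup R H n.+1.
have ev_eq0 x : F n x -> ev x = 0%R -> F n.+1 x.
  move=> Fx x0; split=> // phi hphi.
  have := evE 1 x (exist _ phi hphi) Fx.
  by rewrite x0 conj_sub1 => /= <-.
have [||||C [C0 CD CT Ctot]] := @invariant_cone (Q -> D -> R) Q T.
- by [].
- by move=> v; apply/funext => q; rewrite /T mulg1.
- by move=> q r v; apply/funext => s; rewrite /T mulgA.
- by move=> q r v; apply/funext => s; rewrite /T -!mulgA (QC q).
exists [set x | C (ev x)]; split => /=.
- by move=> x y Fx Fy Cx Cy; rewrite evM //; exact: CD.
- by move=> x y Fx Fy Cx; rewrite !evM ?(ev0 y) ?addr0 ?add0r //; exact: real_lcsS.
- by move=> g x Fx Cx; rewrite evT //; exact: CT.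
- by move=> x Fx; rewrite ev0.
move=> x Fx; rewrite evV //.
have [|||] := Ctot (ev x); last 3 first.
- by constructor 1.
- by move=> /(ev_eq0 _ Fx); constructor 2.
- by constructor 3.
move=> l l0 sum0; apply/funext => r; apply/funext => d.
pose f (q : Q) : R := ev x q d.
suff /(congr1 (fun h => h r)) : f = fun=> 0%R by [].
apply: (@sum_shift_inj _ Q Q (fun i q => q * i) l f) => //.
- by move=> i j q; rewrite -!mulgA (QC i).
- move=> i; pose g := repr i; have [s s0 sP] := proots g; exists s => //.
  apply/funext => q; pose psi := sval d \o conj_sub (repr q).
  (* Along the orbit [j |-> q * i ^+ j], [f] becomes [psi] evaluated at the iterates of [x] under
     conjugation by [g]; [psi] is a functional on layer [n], so [s] annihilates it. *)
  rewrite -[LHS]/((shift_subs ( *%g^~ i) s f \o (fun j => iter j ( *%g^~ i) q)) 0).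
  rewrite -(@shift_subs_comp _ _ _ S) //.
  have -> : f \o (fun j => iter j ( *%g^~ i) q) = psi \o (fun j => iter j (conj_sub g) x).
    apply/funext => j; rewrite /f /=; elim: j x Fx {f l0 sum0} => [//|j IH] y Fy.
    rewrite [in RHS]iterSr -IH; last exact: FJ.
    by rewrite evT // /T -repr_pi.
  rewrite (@shift_subs_comp _ _ _ S (conj_sub g)) //=.
  by apply: sP => //; apply: central_hom_conj_sub; exact: (svalP d).
move=> q; have := congr1 (fun v : Q -> D -> R => v q d) sum0.
by rewrite !fct_sumE.
Qed.

Hypothesis proots0 : forall g, positive_roots R (conj_sub g : H -> H) 0.
Hypothesis resH : residually_torsion_free_nilpotent H.

(** Lexicographic order: the sign of [x] is read in the last [real_lcs n] containing it, which
    exists for [x <> 1] by [real_lcs_bigcap]. In a product of elements of different layers the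
    smaller index decides. *)
Lemma normal_cone : exists P : set H, [/\ ~ P 1,
  forall x y, P x -> P y -> P (x * y),
  forall g x, P x -> P (conj_sub g x) &
  forall x, [\/ P x, x = 1 | P x^-1]].
Proof.
have proots n g : positive_roots R (conj_sub g : H -> H) n.
  by elim: n => // n IH; exact: positive_rootsS (proots0 g) IH.
have cones n := layer_cone (proots n).
have [C CP] := choice cones.
exists [set x | exists2 n, F n x & C n x]; split=> /=.
- move=> [n _]; have [_ _ _ C1 _] := CP n; apply: C1.
  by have [] := real_lcs_subgroup R H n.+1.
- move=> x y [m Fx Cx] [n Fy Cy]; have [mn|nm|mn] := ltngtP m n.
  + have [_ CF _ _ _] := CP m.
    exists m; last by apply: (CF x y _ _ Cx).1 => //; exact: real_lcs_mono Fy.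
    have [_ FM _] := real_lcs_subgroup R H m; apply: FM => //.
    by apply: real_lcs_mono Fy; exact: ltnW.
  + have [_ CF _ _ _] := CP n.
    exists n; last by apply: (CF y x _ _ Cy).2 => //; exact: real_lcs_mono Fx.
    have [_ FM _] := real_lcs_subgroup R H n; apply: FM => //.
    by apply: real_lcs_mono Fx; exact: ltnW.
  + subst n; have [CM _ _ _ _] := CP m; have [_ FM _] := real_lcs_subgroup R H m.
    by exists m; [exact: FM|exact: CM].
- move=> g x [n Fx Cx]; have [_ _ CJ _ _] := CP n.
  by exists n; [exact: real_lcs_morph|exact: CJ].
move=> x; have [x1|x1] := pselect (x = 1); first by constructor 2.
have [n [Fn Fn1]] : exists n, F n x /\ ~ F n.+1 x.
  apply: contrapT => h; apply: x1; apply: (real_lcs_bigcap (R := R) resH).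
  by elim=> // n Fn; apply: contrapT => Fn1; apply: h; exists n.
have [_ _ _ _ Ctot] := CP n; case: (Ctot x Fn) => // Cx.
  by constructor 1; exists n.
by constructor 3; exists n => //; have [_ _ FV] := real_lcs_subgroup R H n; exact: FV.
Qed.

End Layers.

(** * Bi-orders from positive cones, and the order on the extension *)

Lemma bi_orderable_cone (G : groupType) (P : set G) : ~ P 1 ->
  (forall x y, P x -> P y -> P (x * y)) -> (forall x y, P x -> P (x ^ y)) ->
  (forall x, [\/ P x, x = 1 | P x^-1]) -> bi_orderable G.
Proof.
move=> P1 PM PJ Ptot; exists (fun x y => P (x^-1 * y)); split.
- by move=> x; rewrite mulVg.
- by move=> x y z xy yz; have := PM _ _ xy yz; rewrite mulgA mulgK.
- move=> x y; case: (Ptot (x^-1 * y)) => [xy||].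
  + by constructor 1.
  + by move=> /mulg1_eq; rewrite invgK; constructor 2.
  + by rewrite invgM invgK; constructor 3.
- move=> u v x uv; split; last by rewrite invgM mulgA mulgVK.
  by have := PJ _ x uv; rewrite /conjg invgM !mulgA.
Qed.

Theorem theoremB (R : realType) (G Phi : groupType) (K : normalClosed G)
    (e : {multiplicative quotg K -> Phi}) :
  bijective e ->
  residually_torsion_free_nilpotent (subg K) ->
  (forall a b : Phi, a * b = b * a) ->
  bi_orderable Phi ->
  finite_dimensional (ab_tensor K R) ->
  (forall (a : Phi) (g : G), e (quotg_pi K g) = a ->
     eigenvalues_positive (conj_action K R g)) ->
  bi_orderable G.
Proof.
move=> ebij resK PhiC [lt [ltxx lt_trans lt_total ltM]] fdV epos.
have ebij_inj := bij_inj ebij.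
have QC (q r : quotg K) : q * r = r * q.
  by apply: ebij_inj; rewrite !gmulfM PhiC.
have proots0 g : positive_roots R (conj_sub g : subg K -> subg K) 0.
  by apply: positive_roots0 => //; exact: epos.
have [P [P1 PM PJ Ptot]] := normal_cone QC proots0 resK.
pose p (g : G) : Phi := e (quotg_pi K g).
have pM g h : p (g * h) = p g * p h by rewrite /p !gmulfM.
have p1 : p 1 = 1 by apply: (mulgI (p 1)); rewrite -pM !mulg1.
have pV g : p g^-1 = (p g)^-1 by apply: (mulgI (p g)); rewrite -pM !mulgV p1.
have pJ g h : p (g ^ h) = p g by rewrite /conjg !pM (PhiC (p g)) mulgA -pM mulVg p1 mul1g.
have pK g : p g = 1 <-> g \in K.
  rewrite -p1; split=> [/ebij_inj/quotg_eqP|gK]; first by rewrite mulg1 gpredV.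
  by apply: (congr1 e); apply/quotg_eqP; rewrite mulg1 gpredV.
have lt1M a b : lt 1 a -> lt 1 b -> lt 1 (a * b).
  move=> a1 b1; apply: lt_trans a1 _.
  by have [_] := ltM _ _ a b1; rewrite mulg1.
(* The image in [Phi] decides first, and the cone of [K] decides on the kernel; conjugation
   preserves the first part because [Phi] is abelian. *)
apply: (@bi_orderable_cone G
  [set g | lt 1 (p g) \/ exists2 k : subg K, val k = g & P k]) => /=.
- move=> [|[k k1]]; first by rewrite p1; exact: ltxx.
  by rewrite (_ : k = 1) //; apply: val_inj; exact: k1.
- move=> x y; rewrite pM.
  have pk (k : subg K) : p (val k) = 1 by apply/pK; exact: subg_valP.
  move=> [x1|[k <- Pk]] [y1|[l <- Pl]]; rewrite ?pk ?mulg1 ?mul1g;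
    [left; exact: lt1M|by left|by left|].
  by right; exists (k * l); [exact: (valM k l)|exact: PM].
- move=> x y; rewrite pJ => -[x1|[k <- Pk]]; [by left|right].
  exists (conj_sub y^-1 k); last exact: PJ.
  by have := conj_subE y^-1 k; rewrite invgK /conjg mulgA.
- move=> x; have [x1|x1|x1] := lt_total 1 (p x).
  + by constructor 1; left.
  + pose k : subg K := Subg ((pK x).1 (esym x1)).
    have [Pk|k1|Pk] := Ptot k.
    * by constructor 1; right; exists k.
    * by constructor 2; rewrite -[x]/(val k) k1.
    * by constructor 3; right; exists k^-1 => //; rewrite multiplicativeV.
  + constructor 3; left; rewrite pV.
    by have [] := ltM _ _ (p x)^-1 x1; rewrite mulgV mul1g.
Qed.
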